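(* Let $3<p<\infty$ and $\frac1p+\frac1q=1$. Let $\mathcal J:l_p\to l_q$ be the mapping $\mathcal J(x)=(|t_1|^{p-1}\mathrm{sign}(t_1),|t_2|^{p-1}\mathrm{sign}(t_2),\dots)$ for $x=(t_1,t_2,\dots)\in l_p$. Then $\mathcal J$ is Fréchet differentiable on $l_p$ and, for any $\bar x=(\bar t_1,\bar t_2,\dots)\in l_p$, $$\nabla\mathcal J(\bar x)=(p-1)\begin{pmatrix}|\bar t_1|^{p-2}&0&\cdots\\0&|\bar t_2|^{p-2}&0\\\vdots&0&\ddots\end{pmatrix}.$$ More precisely, $\nabla\mathcal J(\bar x):l_p\to l_q$ is a pointwise multiplication operator on $l_p$ and, for $v=\{t_n\}_{n=1}^\infty\in l_p$, $$\nabla\mathcal J(\bar x)(v)=\{(p-1)|\bar t_n|^{p-2}t_n\}_{n=1}^\infty\in l_q,$$ and $$\|\nabla\mathcal J(\bar x)(v)\|_q\le(p-1)\|\bar x\|_p^{p-2}\,\|v\|_p.$$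
   Context: $(l_p,\|\cdot\|_p)$ and $(l_q,\|\cdot\|_q)$ are the real sequence spaces. $\nabla\mathcal J(\bar x)$ denotes the Fréchet derivative of $\mathcal J$ at $\bar x$, a continuous linear map $l_p\to l_q$. Infinite diagonal matrices act on sequences (viewed as row vectors) by entrywise multiplication by the diagonal entries. *)

(* Defs.v *)
From HB Require Import structures.
From mathcomp Require Import all_boot all_order all_algebra.
From mathcomp Require Import finmap.
From mathcomp Require Import all_classical all_reals all_analysis.
Set Implicit Arguments.
Unset Strict Implicit.
Unset Printing Implicit Defensive.
Import Order.TTheory GRing.Theory Num.Theory.
Import numFieldNormedType.Exports.
Local Open Scope classical_set_scope.
Local Open Scope ring_scope.

(* l_p is L^p of the counting measure on nat: every function on nat is
   measurable, and since counting-null sets are empty no quotient by almost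
   everywhere equality is needed. *)
Definition lp (R : realType) (p : R) (p1 : 1 <= p) : Type :=
  LfunType (@counting nat R) (p1 : (1 <= p%:E)%E).

Section lp_normed.
Context (R : realType) (p : R) (p1 : 1 <= p).
Local Open Scope ereal_scope.

HB.instance Definition _ := GRing.Lmodule.on (lp p1).

Definition lp_seq (x : lp p1) : nat -> R := x : LfunType _ _.

Definition lp_norm (x : lp p1) : R := fine 'N[@counting nat R]_p%:E[EFin \o lp_seq x].

Lemma lp_normD (x y : lp p1) : (lp_norm (x + y)%R <= lp_norm x + lp_norm y)%R.
Proof. exact: ler_LnormD. Qed.

Lemma lp_normZ (a : R) (x : lp p1) : (lp_norm (a *: x) = `|a| * lp_norm x)%R.
Proof.
apply/EFin_inj; rewrite EFinM.
have := LnormZ (x : LfunType _ _) a.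
rewrite -[in X in _ = X -> _]finite_norm_fine => <-.
exact: (finite_norm_fine ((a *: x)%R : LfunType _ _)).
Qed.

Lemma lp_norm0_eq0 (x : lp p1) : lp_norm x = 0%R -> x = 0%R.
Proof.
move/fine_Lnormr_eq0 => -[A [mA A0 sA]].
apply/LfuneqP => n; apply: contrapT => xn.
have An : A n by apply: sA => /= /(_ I).
have A0n : counting [set n] <= @counting nat R A.
  by apply: le_measure; rewrite ?inE// => _ ->.
by move: A0n; rewrite A0 /counting asboolT// fset_set1 cardfs1 lee_fin ler10.
Qed.

Lemma lp_normE (x : lp p1) :
  (lp_norm x)%:E = (\sum_(k <oo) (`|lp_seq x k| `^ p)%:E) `^ p^-1.
Proof.
have p0 : (0 < p)%R by rewrite (lt_le_trans ltr01).
by rewrite [LHS]finite_norm_fine Lnorm_counting.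
Qed.

HB.instance Definition _ := Lmodule_isNormed.Build R (lp p1)
  lp_normD lp_normZ lp_norm0_eq0.

End lp_normed.
Coercion lp_seq : lp >-> Funclass.

Fact gt3_gt1 (R : realType) (p : R) : 3 < p -> 1 < p.
Proof. by apply: lt_trans; rewrite ltr1n. Qed.

Section duality.
Context (R : realType) (p q : R).
Hypotheses (p1 : 1 < p) (pq : p^-1 + q^-1 = 1).

Lemma conjugate_gt0 : 0 < q.
Proof.
rewrite -invr_gt0 -(addKr p^-1 q^-1) pq addrC subr_gt0.
by rewrite invf_lt1// (lt_trans ltr01).
Qed.

Lemma conjugate_ge1 : 1 <= q.
Proof.
rewrite -invf_le1 ?conjugate_gt0// -pq lerDr invr_ge0.
by rewrite ltW// (lt_trans ltr01).
Qed.

Lemma conjugateE : (p - 1) * q = p.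
Proof.
have p0 : p != 0 by rewrite gt_eqF// (lt_trans ltr01).
have q0 : q != 0 by rewrite gt_eqF// conjugate_gt0.
have := congr1 (fun z => z * (p * q)) pq.
rewrite /= mulrDl mulKf// [p * q]mulrC mulKf// mul1r => e.
by rewrite mulrBl mul1r [p * q]mulrC -e addrAC subrr add0r.
Qed.

Definition duality_seq (t : nat -> R) : nat -> R :=
  fun n => `|t n| `^ (p - 1) * Num.sg (t n).

Lemma duality_seq_Lfun (x : lp (ltW p1)) :
  duality_seq x \in Lfun (@counting nat R) q%:E.
Proof.
have p0 : 0 < p by rewrite (lt_trans ltr01).
have q0 := conjugate_gt0.
apply/andP; split; first by rewrite inE.
rewrite inE /= /finite_norm Lnorm_counting//.
apply: poweR_lty.
have := @Lfunction_finite _ _ _ _ _ (ltW p1 : (1 <= p%:E)%E) x.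
rewrite /finite_norm Lnorm_counting// => /lty_poweRy.
rewrite invr_eq0 gt_eqF// => /(_ isT).
congr (_ < _)%E; apply: eq_eseriesr => n _ /=.
congr EFin; rewrite -[LHS]/(`|x n| `^ p).
rewrite /duality_seq normrM normr_sg.
have [->|xn0] := eqVneq (x n) 0.
  by rewrite /= mulr0 normr0 !powR0 ?gt_eqF.
by rewrite mulr1 ger0_norm ?powR_ge0// -powRrM conjugateE.
Qed.

Definition duality_map (x : lp (ltW p1)) : lp conjugate_ge1 :=
  Lfun_Sub (conjugate_ge1 : (1 <= q%:E)%E) (duality_seq_Lfun x).

End duality.
Arguments duality_map {R p q} p1 pq x.

(* The row vector v times the infinite diagonal matrix with diagonal d. *)
Definition diag_apply (R : realType) (d v : nat -> R) : nat -> R :=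
  fun n => v n * d n.

(* Main.v *)
Require Import Defs.
From HB Require Import structures.
From mathcomp Require Import all_boot all_order all_algebra.
From mathcomp Require Import all_classical all_reals all_analysis.
From mathcomp Require Import ring lra.
From mathcomp Require Import measurable_realfun.
Import Order.TTheory GRing.Theory Num.Theory.
Import numFieldNormedType.Exports.
Local Open Scope classical_set_scope.
Local Open Scope ring_scope.

(** The duality map acts coordinatewise by the signed power
[spow (p - 1) t = |t|^(p-1) sign t], whose derivative is
[(p - 1) |t|^(p-2)]; the candidate derivative at [x] is therefore
multiplication by the sequence [(p - 1) |x_n|^(p-2)].  Two ingredients turn
this coordinatewise fact into Frechet differentiability.

Since [p - 1 >= 2], the signed power has a second-order remainder
whose dependence on the base point is explicit ([spow_taylor]):
[|spow s (a + h) - spow s a - s |a|^(s-1) h| <= s^2 |h|^2 (|a| + |h|)^(s-2)].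

Hoelder's inequality ([Lnorm_le_powRM]) converts a pointwise bound
[|f| <= c |v|^a |w|^b] with [(a + b) q = p] into the norm bound
[|f|_q <= c |v|_p^a |w|_p^b].  As [(p - 1) q = p], it applies to any splitting
of [p - 1] into two positive exponents:
- [1 + (p - 2)] shows that the diagonal operator maps [l_p] to [l_q] with the
  announced bound, hence is continuous ([norm_diag_op]);
- [2 + (p - 3)], with [w = |x| + |h|] and Minkowski's inequality, shows
  that the remainder has [q]-norm at most
  [(p - 1)^2 |h|^2 (|x| + |h|)^(p-3)], which is [o(h)]
  ([duality_map_remainder]).  Both exponents are positive because [p > 3].

The differential then equals the diagonal operator by uniqueness. *)

(** * Second-order expansion of the signed power *)

Section signed_power.
Set Implicit Arguments.
Unset Strict Implicit.
Context {R : realType}.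
Implicit Types a b h s M : R.

Lemma powR_MVT s a b : 0 < a -> a <= b ->
  exists2 c, a <= c <= b & b `^ s - a `^ s = s * c `^ (s - 1) * (b - a).
Proof.
move=> a0 ab.
have pos x : x \in `[a, b] -> 0 < x.
  by rewrite in_itv/= => /andP[ax _]; exact: lt_le_trans ax.
have [||c] := @MVT_segment R (@powR R ^~ s) (fun x => s * x `^ (s - 1)) a b ab.
- move=> x xab; apply: is_derive1_powR; apply: pos.
  exact: subset_itv_oo_cc xab.
- apply: derivable_within_continuous => x xab.
  by apply: derivable_powR; rewrite in_itv/= andbT; exact: pos.
by rewrite in_itv/= => cab e; exists c.
Qed.

(** The mean value theorem in a form that does not depend on the order of [a]
and [b], so that it can be iterated: [c] is kept close to [a] for the second
application and below [max a b] to bound the remaining power. *)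
Lemma powR_mean s a b : 0 < a -> 0 < b ->
  exists2 c, [/\ 0 < c, c <= Num.max a b & `|c - a| <= `|b - a|] &
    b `^ s - a `^ s = s * c `^ (s - 1) * (b - a).
Proof.
move=> a0 b0; have [ab|/ltW ba] := leP a b.
  have [c /andP[ac cb] e] := powR_MVT s a0 ab; exists c => //.
  by split; [exact: lt_le_trans ac|lra|rewrite !ger0_norm; lra].
have [c /andP[bc ca] e] := powR_MVT s b0 ba; exists c; last by lra.
by split; [exact: lt_le_trans bc|lra|rewrite !ler0_norm; lra].
Qed.

(** Two applications of the mean value theorem: to [t^s] between [a] and [b],
then to [t^(s-1)] between [a] and the intermediate point found. *)
Lemma powR_taylor2 s a b M : 2 <= s -> 0 < a <= M -> 0 < b <= M ->
  `|b `^ s - a `^ s - s * a `^ (s - 1) * (b - a)|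
    <= s * (s - 1) * (`|b - a| ^+ 2 * M `^ (s - 2)).
Proof.
move=> s2 /andP[a0 aM] /andP[b0 bM].
have [c [c0 cab cba] ->] := powR_mean s a0 b0.
rewrite -mulrBl -mulrBr.
have [d [d0 dac _] ->] := powR_mean (s - 1) a0 c0.
have cM : c <= M by rewrite (le_trans cab)// ge_max aM.
have dM : d <= M by rewrite (le_trans dac)// ge_max aM.
rewrite !normrM [`|s|]ger0_norm; last by lra.
rewrite [`|s - 1|]ger0_norm; last by lra.
rewrite [`|_ `^ _|]ger0_norm ?powR_ge0//.
have -> : s - 1 - 1 = s - 2 by lra.
have dMs : d `^ (s - 2) <= M `^ (s - 2).
  by apply: ge0_ler_powR; rewrite ?nnegrE; lra.
rewrite -!mulrA; apply: ler_wpM2l; first by lra.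
apply: ler_wpM2l; first by lra.
rewrite [leRHS]mulrA [leRHS]mulrC; apply: ler_pM; rewrite ?powR_ge0 ?mulr_ge0//.
by rewrite ler_wpM2r.
Qed.

Definition spow s t : R := `|t| `^ s * Num.sg t.

Lemma spowN s t : spow s (- t) = - spow s t.
Proof. by rewrite /spow normrN sgrN mulrN. Qed.

Lemma norm_spow s t : 0 < s -> `|spow s t| = `|t| `^ s.
Proof.
move=> s0; rewrite /spow normrM ger0_norm ?powR_ge0// normr_sg.
have [->|_] := eqVneq t 0; last by rewrite mulr1.
by rewrite mulr0 normr0 powR0// gt_eqF.
Qed.

Lemma gt0_spow s t : 0 < t -> spow s t = t `^ s.
Proof. by move=> t0; rewrite /spow gtr0_norm// gtr0_sg// mulr1. Qed.

(** When both endpoints are dominated by the increment no cancellation is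
needed: the three terms are separately at most [|h|^s], [|h|^s] and
[s |h|^s], and [s + 2 <= s^2] for [s >= 2]. *)
Lemma spow_taylor_far s a h : 2 <= s -> `|a| <= `|h| -> `|a + h| <= `|h| ->
  `|spow s (a + h) - spow s a - s * `|a| `^ (s - 1) * h|
    <= s ^+ 2 * `|h| `^ s.
Proof.
move=> s2 ah ahh.
have mono (x r : R) : 0 <= r -> `|x| <= `|h| -> `|x| `^ r <= `|h| `^ r.
  by move=> r0 xh; apply: ge0_ler_powR; rewrite ?nnegrE.
have lin : `|s * `|a| `^ (s - 1) * h| <= s * `|h| `^ s.
  rewrite !normrM [`|_ `^ _|]ger0_norm ?powR_ge0// ger0_norm; last by lra.
  rewrite -mulrA ler_wpM2l//; first by lra.
  rewrite -[leRHS](mulr_powRB1 (normr_ge0 h)); last by lra.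
  rewrite mulrC ler_wpM2l//; apply: mono => //; lra.
apply: le_trans (ler_normB _ _) _; apply: le_trans (lerD (ler_normB _ _) lin) _.
rewrite !norm_spow; [|lra..].
have Y := mono (a + h) s ltac:(lra) ahh.
have A := mono a s ltac:(lra) ah.
apply: (@le_trans _ _ ((s + 2) * `|h| `^ s)); first by lra.
by rewrite ler_wpM2r ?powR_ge0//; nra.
Qed.

(** If [a] and [a + h] lie strictly on the same side of [0], the signed power is
smooth between them.  Otherwise the segment meets [0], so [|a|] and [|a + h|]
are at most [|h|] and the crude bound [spow_taylor_far] is enough. *)
Lemma spow_taylor s a h : 2 <= s ->
  `|spow s (a + h) - spow s a - s * `|a| `^ (s - 1) * h|
    <= s ^+ 2 * (`|h| ^+ 2 * (`|a| + `|h|) `^ (s - 2)).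
Proof.
move=> s2.
(* The signed power is odd, so the pair (a, h) may be replaced by (-a, -h). *)
wlog a0 : a h / 0 <= a.
  move=> W; have [/W//|a0] := leP 0 a.
  have := W (- a) (- h); rewrite !normrN -opprD !spowN.
  rewrite oppr_ge0 (ltW a0) => /(_ isT).
  by rewrite mulrN -!opprD normrN.
have h0 := normr_ge0 h; have hh := ler_norm h.
have [/andP[a_gt0 ah_gt0]|near0] := boolP ((0 < a) && (0 < a + h)).
  have hE : h = (a + h) - a by ring.
  rewrite !gt0_spow// (gtr0_norm a_gt0) {2 3}hE.
  apply: le_trans (powR_taylor2 (M := a + `|h|) s2 _ _) _; [lra..|].
  by rewrite -hE ler_wpM2r ?mulr_ge0 ?exprn_ge0 ?powR_ge0//; nra.
have {}near0 : a = 0 \/ a + h <= 0.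
  move: near0; rewrite negb_and -!leNgt => /orP[a_le0|]; last by right.
  by left; apply/le_anti; rewrite a_le0.
apply: le_trans (spow_taylor_far s2 _ _) _.
- rewrite ger0_norm//; case: near0 => [->//|]; have := ler_norm (- h).
  rewrite normrN; lra.
- case: near0 => [->|ah0]; first by rewrite add0r.
  by rewrite !ler0_norm; lra.
rewrite ler_wpM2l ?sqr_ge0//.
have -> : `|h| `^ s = `|h| ^+ 2 * `|h| `^ (s - 2).
  rewrite -powR_mulrn// -powRD; first by congr (_ `^ _); lra.
  by apply/implyP => /eqP; lra.
have hah : `|h| <= `|a| + `|h| by rewrite lerDr.
by rewrite ler_wpM2l ?sqr_ge0// ge0_ler_powR ?nnegrE//; lra.
Qed.

End signed_power.

(** * Hoelder's inequality for products of powers *)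

Section hoelder_interpolation.
Set Implicit Arguments.
Unset Strict Implicit.
Context d {T : measurableType d} {R : realType}.
Variable mu : {measure set T -> \bar R}.
Local Notation "'N_ p [ f ]" := (Lnorm mu p%:E (EFin \o f)).
Local Open Scope ereal_scope.
Implicit Types (f g v w : T -> R) (a b c p q r : R).

Lemma powR_norm_comp_measurable f a : measurable_fun setT f ->
  measurable_fun setT (fun x => `|f x| `^ a)%R.
Proof.
move=> mf; apply: (measurableT_comp (measurable_powR _)).
exact: (measurableT_comp (@normr_measurable _ _)).
Qed.

Lemma le_Lnorm f g p : (0 < p)%R ->
  measurable_fun setT f -> measurable_fun setT g ->
  (forall x, `|f x| <= `|g x|)%R -> 'N_p[f] <= 'N_p[g].
Proof.
move=> p0 mf mg fg; rewrite !unlock; apply: gt0_ler_poweR.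
- by rewrite invr_ge0 ltW.
- by rewrite in_itv/= leey andbT integral_ge0// => x _; rewrite poweR_ge0.
- by rewrite in_itv/= leey andbT integral_ge0// => x _; rewrite poweR_ge0.
apply: ge0_le_integral => //= [||x _].
- by apply/measurable_EFinP; exact: powR_norm_comp_measurable.
- by apply/measurable_EFinP; exact: powR_norm_comp_measurable.
by rewrite lee_fin ge0_ler_powR ?nnegrE// ltW.
Qed.

Lemma Lnorm_powR f p r : (0 < r)%R ->
  'N_p[(fun x => `|f x| `^ r)%R] = 'N_(r * p)%R[f] `^ r.
Proof.
move=> r0; rewrite [in LHS]unlock [in RHS]unlock -poweRrM.
rewrite [in RHS]invfM [in RHS]mulrAC mulVf ?gt_eqF// mul1r.
congr (_ `^ _); apply: eq_integral => x _ /=.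
by rewrite ger0_norm ?powR_ge0// powRrM.
Qed.

Lemma Lnorm_scale f c p : (0 < p)%R -> (0 <= c)%R -> measurable_fun setT f ->
  'N_p[(fun x => c * f x)%R] = c%:E * 'N_p[f].
Proof.
move=> p0 c0 mf; rewrite unlock.
under eq_integral => x _.
  rewrite [X in (X `^ _)](_ : _ = c%:E * `|f x|%:E); last first.
    by rewrite -EFinM/= normrM (ger0_norm c0).
  rewrite poweRM ?lee_fin//; over.
rewrite /= ge0_integralZl_EFin ?powR_ge0//; last first.
  by apply/measurable_EFinP; exact: powR_norm_comp_measurable.
have I0 : 0 <= \int[mu]_x (`|f x| `^ p)%:E.
  by apply: integral_ge0 => x _; rewrite lee_fin powR_ge0.
by rewrite poweRM ?lee_fin ?powR_ge0// poweR_EFin -powRrM mulfV ?gt_eqF// powRr1.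
Qed.

(** Hoelder's inequality with the conjugate exponents [(a + b) / a] and
[(a + b) / b], applied to the [q]-th powers of the two factors: since
[(a + b) q = p], both resulting norms are powers of [p]-norms. *)
Lemma Lnorm_powRM_le v w a b p q : (0 < a)%R -> (0 < b)%R -> (0 < q)%R ->
    ((a + b) * q = p)%R -> measurable_fun setT v -> measurable_fun setT w ->
  'N_q[(fun x => `|v x| `^ a * `|w x| `^ b)%R] <= 'N_p[v] `^ a * 'N_p[w] `^ b.
Proof.
move=> a0 b0 q0 pE mv mw.
have s0 : (0 < a + b)%R by rewrite addr_gt0.
pose V x := (`|v x| `^ (a * q))%R; pose W x := (`|w x| `^ (b * q))%R.
have vwE : 'N_q[(fun x => `|v x| `^ a * `|w x| `^ b)%R] =
    'N_1[(V \* W)%R] `^ q^-1.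
  rewrite Lnorm1 unlock; congr (_ `^ _); apply: eq_integral => x _ /=.
  have VW0 : (0 <= V x * W x)%R by rewrite mulr_ge0 ?powR_ge0.
  have vw0 : (0 <= `|v x| `^ a * `|w x| `^ b)%R by rewrite mulr_ge0 ?powR_ge0.
  by rewrite (ger0_norm VW0) (ger0_norm vw0) powRM ?powR_ge0// -!powRrM.
have := @hoelder _ _ _ mu V W ((a + b) / a)%R ((a + b) / b)%R
  (powR_norm_comp_measurable _ mv) (powR_norm_comp_measurable _ mw).
rewrite !divr_gt0// !invf_div -mulrDl divff ?gt_eqF// => /(_ isT isT erefl).
rewrite !Lnorm_powR ?mulr_gt0//.
have -> : (a * q * ((a + b) / a) = p)%R by rewrite -pE; field; rewrite gt_eqF.
have -> : (b * q * ((a + b) / b) = p)%R by rewrite -pE; field; rewrite gt_eqF.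
move=> le1; rewrite vwE.
have -> : 'N_p[v] `^ a * 'N_p[w] `^ b =
    ('N_p[v] `^ (a * q) * 'N_p[w] `^ (b * q)) `^ q^-1.
  by rewrite poweRM ?poweR_ge0// -!poweRrM !mulfK ?gt_eqF.
apply: gt0_ler_poweR => //; first by rewrite invr_ge0 ltW.
- by rewrite in_itv/= leey andbT Lnorm_ge0.
- by rewrite in_itv/= leey andbT mule_ge0 ?poweR_ge0.
Qed.

Lemma Lnorm_le_powRM f v w a b c p q : (0 < a)%R -> (0 < b)%R -> (0 < q)%R ->
    (0 <= c)%R -> ((a + b) * q = p)%R ->
    measurable_fun setT f -> measurable_fun setT v -> measurable_fun setT w ->
    (forall x, `|f x| <= c * (`|v x| `^ a * `|w x| `^ b))%R ->
  'N_q[f] <= c%:E * ('N_p[v] `^ a * 'N_p[w] `^ b).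
Proof.
move=> a0 b0 q0 c0 pE mf mv mw fvw.
have mvw : measurable_fun setT (fun x => `|v x| `^ a * `|w x| `^ b)%R.
  by apply: measurable_funM; exact: powR_norm_comp_measurable.
apply: (@le_trans _ _ 'N_q[(fun x => c * (`|v x| `^ a * `|w x| `^ b))%R]).
  apply: le_Lnorm => // [|x]; first exact: measurable_funM.
  by rewrite [leRHS]ger0_norm// !mulr_ge0 ?powR_ge0.
by rewrite Lnorm_scale// lee_wpmul2l ?lee_fin// Lnorm_powRM_le.
Qed.

End hoelder_interpolation.

(** * Diagonal operators between sequence spaces *)

Section diagonal_operator.
Set Implicit Arguments.
Unset Strict Implicit.
Context {R : realType}.

Lemma EFin_lp_norm (p : R) (p1 : 1 <= p) (x : lp p1) :
  `|x|%:E = Lnorm (@counting nat R) p%:E (EFin \o lp_seq x).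
Proof. exact: (finite_norm_fine (x : LfunType _ _)). Qed.

Variables (p q : R) (p1 : 1 <= p) (q1 : 1 <= q).

(** The second factor is a bare sequence with a bound on its norm, so that it
can be the sum of the absolute values of two sequences without being packaged
as an element of [lp]. *)
Lemma lp_norm_le_powRM (z : lp q1) (v : lp p1) (w : nat -> R) (N a b c : R) :
    0 < a -> 0 < b -> 0 <= c -> (a + b) * q = p -> 0 <= N ->
    (Lnorm (@counting nat R) p%:E (EFin \o w) <= N%:E)%E ->
    (forall n, `|z n| <= c * (`|v n| `^ a * `|w n| `^ b)) ->
  `|z| <= c * (`|v| `^ a * N `^ b).
Proof.
move=> a0 b0 c0 pE N0 wN zvw; have q0 : 0 < q by apply: lt_le_trans q1.
rewrite -lee_fin EFin_lp_norm.
apply: le_trans (Lnorm_le_powRM counting a0 b0 q0 c0 pE _ _ _ zvw) _ => //.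
rewrite EFinM lee_wpmul2l// -EFin_lp_norm EFinM poweR_EFin.
rewrite lee_wpmul2l ?lee_fin ?powR_ge0// -poweR_EFin.
apply: gt0_ler_poweR => //; first exact: ltW.
- by rewrite in_itv/= leey andbT Lnorm_ge0.
- by rewrite in_itv/= leey andbT lee_fin.
Qed.

Variables (b c : R) (c0 : 0 <= c) (b0 : 0 < b) (pE : (1 + b) * q = p).
Variable x : lp p1.

Lemma diag_apply_Lfun (v : lp p1) :
  c \*: diag_apply (fun n => `|x n| `^ b) v \in Lfun (@counting nat R) q%:E.
Proof.
apply/andP; split; first by rewrite inE.
rewrite inE /= /finite_norm.
have q0 : 0 < q by apply: lt_le_trans q1.
apply: le_lt_trans (@Lnorm_le_powRM _ _ _ counting _ (lp_seq v) (lp_seq x) _ _ _ _ _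
  ltr01 b0 q0 c0 pE _ _ _ _) _ => //.
  move=> n; rewrite /diag_apply/= normrM (ger0_norm c0) ler_wpM2l//.
  by rewrite normrM powRr1// [`|_ `^ _|]ger0_norm ?powR_ge0.
by rewrite -!EFin_lp_norm !poweR_EFin -!EFinM ltry.
Qed.

Definition diag_op (v : lp p1) : lp q1 :=
  Lfun_Sub (q1 : (1 <= q%:E)%E) (diag_apply_Lfun v).

Lemma diag_opE (v : lp p1) n : diag_op v n = c * `|x n| `^ b * v n.
Proof. by rewrite mulrAC -mulrA. Qed.

Lemma diag_op_linear : linear diag_op.
Proof.
move=> k u v; apply/LfuneqP => n.
rewrite -[LHS]/(lp_seq (diag_op (k *: u + v)) n).
rewrite -[RHS]/(k * diag_op u n + diag_op v n) !diag_opE.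
by rewrite -[lp_seq (k *: u + v) n]/(k * u n + v n) mulrDr mulrCA.
Qed.

HB.instance Definition _ := GRing.isLinear.Build R (lp p1) (lp q1) *:%R diag_op
  diag_op_linear.

Lemma norm_diag_op v : `|diag_op v| <= c * `|x| `^ b * `|v|.
Proof.
rewrite mulrAC -mulrA -[X in _ * (X * _)]powRr1//.
apply: (lp_norm_le_powRM (w := x)) => //; first by rewrite EFin_lp_norm.
move=> n; rewrite diag_opE !normrM (ger0_norm c0) powRr1//.
by rewrite [`|_ `^ _|]ger0_norm ?powR_ge0// -mulrA [X in _ * X]mulrC.
Qed.

Lemma diag_op_continuous : continuous diag_op.
Proof.
apply/linear_bounded_continuous/linear_boundedP.
near=> r => v; apply: le_trans (norm_diag_op v) _.
by rewrite ler_wpM2r//; near: r; exact: nbhs_pinfty_ge.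
Unshelve. all: by end_near. Qed.

End diagonal_operator.

(** * The derivative of the duality map *)

Section duality_map_derivative.
Set Implicit Arguments.
Unset Strict Implicit.
Context {R : realType}.
Variables (p q : R) (p3 : 3 < p) (pq : p^-1 + q^-1 = 1).

Let p1 := gt3_gt1 p3.
Local Notation J := (duality_map p1 pq).

Lemma pB1_ge0 : 0 <= p - 1. Proof. have := p3; lra. Qed.

Lemma pB2_gt0 : 0 < p - 2. Proof. have := p3; lra. Qed.

Lemma derivative_exponentE : (1 + (p - 2)) * q = p.
Proof. by rewrite -[RHS](conjugateE p1 pq); congr (_ * _); ring. Qed.

Lemma remainder_exponentE : (2 + (p - 3)) * q = p.
Proof. by rewrite -[RHS](conjugateE p1 pq); congr (_ * _); ring. Qed.

Definition duality_derivative (x : lp (ltW p1)) :=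
  diag_op (conjugate_ge1 p1 pq) pB1_ge0 pB2_gt0 derivative_exponentE x.

(** Coordinatewise this is [spow_taylor] with [s = p - 1]; the exponents of
[|h n|] and of [|x n| + |h n|] are [2] and [p - 3], which add up to [p - 1]
as Hoelder's inequality requires. *)
Lemma duality_map_remainder (x h : lp (ltW p1)) :
  `|J (h + x) - (J x + duality_derivative x h)|
    <= (p - 1) ^+ 2 * (`|h| `^ 2 * (`|x| + `|h|) `^ (p - 3)).
Proof.
have p_gt3 := p3.
pose w (n : nat) : R := `|x n| + `|h n|.
apply: (lp_norm_le_powRM (w := w)) => //; rewrite ?addr_ge0 ?sqr_ge0//.
- lra.
- exact: remainder_exponentE.
- rewrite EFinD !EFin_lp_norm -[in leRHS]Lnorm_abse -[X in (_ <= _ + X)%E]Lnorm_abse.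
  apply: (@minkowski_EFin _ _ _ counting (fun n => `|x n|) (fun n => `|h n|)) => //.
  exact: ltW.
move=> n.
rewrite -[lp_seq _ n]/(spow (p - 1) (h n + x n)
  - (spow (p - 1) (x n) + duality_derivative x h n)).
rewrite diag_opE opprD addrA [h n + x n]addrC.
rewrite [`|w n|]ger0_norm ?addr_ge0// powR_mulrn//.
have := @spow_taylor R (p - 1) (x n) (h n).
have -> : p - 1 - 1 = p - 2 by ring.
have -> : p - 1 - 2 = p - 3 by ring.
by apply; lra.
Qed.

Lemma duality_map_expansion (x : lp (ltW p1)) :
  J \o shift x = cst (J x) + duality_derivative x +o_ 0 id.
Proof.
apply/eqaddoP => e e0.
have p_gt3 := p3.
(* For |h| <= 1 the remainder is at most K |h|^2; dividing by K + 1 below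
   avoids a case distinction on K = 0. *)
pose K := (p - 1) ^+ 2 * (`|x| + 1) `^ (p - 3).
have K0 : 0 <= K by rewrite mulr_ge0 ?sqr_ge0 ?powR_ge0.
near=> h; apply: le_trans (duality_map_remainder x h) _.
have h1 : `|h| <= 1 by near: h; apply: nbhs0_le.
have he : `|h| <= e / (K + 1).
  by near: h; apply: nbhs0_le; rewrite divr_gt0// ltr_wpDl.
apply: (@le_trans _ _ (K * `|h| * `|h|)).
  rewrite powR_mulrn// -[leRHS]mulrA -expr2 /K -mulrA ler_wpM2l ?sqr_ge0//.
  rewrite [leRHS]mulrC ler_wpM2l ?sqr_ge0//.
  by apply: ge0_ler_powR; rewrite ?nnegrE ?lerD2l//; [lra|rewrite addr_ge0..].
rewrite ler_wpM2r//; apply: (@le_trans _ _ ((K + 1) * `|h|)).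
  by rewrite ler_wpM2r// lerDl.
by rewrite mulrC -ler_pdivlMr// ltr_wpDl.
Unshelve. all: by end_near. Qed.

Lemma duality_map_diff (x : lp (ltW p1)) :
  'd J x = duality_derivative x :> (_ -> _).
Proof.
by apply: diff_unique; [exact: diag_op_continuous|exact: duality_map_expansion].
Qed.

Lemma duality_map_differentiable (x : lp (ltW p1)) : differentiable J x.
Proof.
apply/diff_locallyP; rewrite duality_map_diff; split.
  exact: diag_op_continuous.
exact: duality_map_expansion.
Qed.

End duality_map_derivative.

Theorem theorem6p1 (R : realType) (p q : R) (p3 : 3 < p)
    (pq : p^-1 + q^-1 = 1) :
  let J := duality_map (gt3_gt1 p3) pq in
  forall x : lp (ltW (gt3_gt1 p3)),
    [/\ differentiable J x,
        forall v : lp _, lp_seq ('d J x v) =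
          (p - 1) \*: diag_apply (fun n => `|x n| `^ (p - 2)) v,
        forall (v : lp _) (n : nat),
          lp_seq ('d J x v) n = (p - 1) * `|x n| `^ (p - 2) * v n &
        forall v : lp _, `|'d J x v| <= (p - 1) * `|x| `^ (p - 2) * `|v| ].
Proof.
move=> J x; rewrite duality_map_diff.
split=> [|//|v n|v].
- exact: duality_map_differentiable.
- exact: diag_opE.
- exact: norm_diag_op.
Qed.
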